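(* Let $m\ge 0$ and $n$ be integers with $m\le n$, and let $H^{[-m]}_{k}$ denote the monic generalized Hermite polynomials with parameter $-m$. If $\xi<\eta$ are two positive real consecutive zeros of $H^{[-m]}_{n+1}$, then there exists a positive real zero $\zeta$ of $H^{[-m]}_{n}$ such that $\xi<\zeta<\eta$.
   Context: For a real parameter $\mu$, the generalized monic Hermite polynomials are $$H^{[\mu]}_{2n}(x)=\sum_{k=0}^n\binom{n+\mu-1/2}{n-k}\frac{(-1)^{n-k}n!}{k!}x^{2k},\qquad H^{[\mu]}_{2n+1}(x)=\sum_{k=0}^n\binom{n+\mu+1/2}{n-k}\frac{(-1)^{n-k}n!}{k!}x^{2k+1},$$ with $\binom{a}{k}=a(a-1)\cdots(a-k+1)/k!$. *)

(* Defs.v *)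
From mathcomp Require Import all_boot all_order all_algebra.
From mathcomp Require Import reals.

Set Implicit Arguments.
Unset Strict Implicit.
Unset Printing Implicit Defensive.

Import Order.TTheory GRing.Theory Num.Theory.
Local Open Scope ring_scope.

(* a (a - 1) ... (a - k + 1) / k! for a real upper argument a *)
Definition gbinom (R : realType) (a : R) (k : nat) : R :=
  (\prod_(i < k) (a - i%:R)) / k`!%:R.

Definition genHermite_even (R : realType) (mu : R) (n : nat) : {poly R} :=
  \sum_(k < n.+1)
    (gbinom (n%:R + mu - 1 / 2%:R) (n - k)
      * ((-1) ^+ (n - k) * n`!%:R / k`!%:R)) *: 'X^(2 * k)%N.

Definition genHermite_odd (R : realType) (mu : R) (n : nat) : {poly R} :=
  \sum_(k < n.+1)
    (gbinom (n%:R + mu + 1 / 2%:R) (n - k)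
      * ((-1) ^+ (n - k) * n`!%:R / k`!%:R)) *: 'X^(2 * k + 1)%N.

(* The polynomial of degree N, so that genHermite mu (2n) and
   genHermite mu (2n+1) are the even and odd families at n. *)
Definition genHermite (R : realType) (mu : R) (N : nat) : {poly R} :=
  if odd N then genHermite_odd mu N./2 else genHermite_even mu N./2.

Definition consecutive_roots (R : realType) (p : {poly R}) (a b : R) : Prop :=
  [/\ root p a, root p b, a < b & forall c : R, a < c < b -> ~~ root p c].

(* Main.v *)
(* Between two positive zeros of x^(2 mu) H_(n+1) (n even), or of H_(n+1)
   (n odd), Rolle's theorem gives a zero of the derivative. Up to a power of x
   this derivative is a multiple of H_n, namely by n + 1 + 2 mu, respectively
   n + 1; for mu = -m the former is an odd integer, hence nonzero. *)
Require Import Defs.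
From mathcomp Require Import all_boot all_order all_algebra.
From mathcomp Require Import reals.
From mathcomp Require Import topology normedtype derive realfun.
From mathcomp Require Import ring.

Import Order.TTheory GRing.Theory Num.Theory.
Import numFieldNormedType.Exports.
Local Open Scope ring_scope.

(* Rolle's theorem for the quotient p / q *)
Lemma root_wronskian_between (R : realType) (p q : {poly R}) (a b : R) :
    a < b -> root p a -> root p b ->
    (forall x, a <= x <= b -> q.[x] != 0) ->
  exists2 c, a < c < b & root (p^`() * q - p * q^`()) c.
Proof.
move=> ltab /rootP pa0 /rootP pb0 q0.
pose f x := p.[x] * q.[x]^-1.
(* The derivative of p / q, in the shape that the product and inverse rules yield. *)
pose df x := p.[x] * (- q.[x] ^- 2 * q^`().[x]) + q.[x]^-1 * p^`().[x].
have fE x : a <= x <= b -> is_derive x (1 : R) f (df x).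
  move=> /q0 qx0.
  have dp := is_derive_poly p x; have dq := is_derive_poly q x.
  have dV := is_deriveV qx0 dq.
  exact: (is_deriveM dp dV).
have fab : f a = f b by rewrite /f pa0 pb0 !mul0r.
have [||c cab dfc0] := Rolle ltab _ _ fab.
- by move=> x /itvP xab; have [] := fE x _; rewrite ?xab.
- apply: derivable_within_continuous => x /itvP xab.
  by have [] := fE x _; rewrite ?xab.
have {}cab : a < c < b by rewrite !(itvP cab).
have cab' : a <= c <= b by case/andP: cab => /ltW-> /ltW->.
exists c => //; apply/rootP.
have df0 : df c = 0.
  have dfc := fE c cab'.
  by rewrite -(@derive_val _ _ _ _ _ _ _ dfc) (@derive_val _ _ _ _ _ _ _ dfc0).
(* Quotient rule: the Wronskian is [q ^+ 2] times the derivative of p / q. *)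
have -> : (p^`() * q - p * q^`()).[c] = q.[c] ^+ 2 * df c.
  have := q0 c cab'; rewrite /df !(hornerD, hornerN, hornerM).
  move: p.[c] q.[c] p^`().[c] q^`().[c] => x y z t y0.
  by field.
by rewrite df0 mulr0.
Qed.

(** Times k!, both sides are a (a - 1) ... (a - k), with the last or the first factor split off. *)
Lemma mul_gbinom_subr1 (R : realType) (a : R) k :
  (a - k%:R) * gbinom a k = a * gbinom (a - 1) k.
Proof.
rewrite /gbinom !mulrA; congr (_ / _).
transitivity (\prod_(i < k.+1) (a - i%:R)); first by rewrite big_ord_recr mulrC.
rewrite big_ord_recl subr0; congr (_ * _); apply: eq_bigr => i _.
by rewrite /= /bump /= add1n -natr1; ring.
Qed.

(** The constant term dies and term k + 1 becomes term k; the upper arguments agree, as (n + 1) + mu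
    - 1/2 = n + mu + 1/2. *)
Lemma deriv_genHermite_even (R : realType) (mu : R) n :
  (genHermite_even mu n.+1)^`() = (2 * n.+1)%:R *: genHermite_odd mu n.
Proof.
rewrite /genHermite_even /genHermite_odd raddf_sum /= big_ord_recl.
rewrite muln0 derivZ expr0 derivC scaler0 add0r scaler_sumr.
apply: eq_bigr => k _; rewrite lift0 subSS derivZ derivXn scalerA.
have -> : ((2 * k.+1).-1 = 2 * k + 1)%N by rewrite mulnS addnC addn2 addn1.
rewrite -['X^_ *+ _]scaler_nat scalerA; congr (_ *: _).
have -> : n.+1%:R + mu - 1 / 2%:R = n%:R + mu + 1 / 2%:R :> R.
  by rewrite -natr1; field.
rewrite !factS !natrM; field.
by rewrite nat1r !pnatr_eq0 -lt0n fact_gt0.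
Qed.

(* The left-hand side is X^(1 - 2 mu) (X^(2 mu) H_(2n+1))'. *)
Lemma deriv_genHermite_odd (R : realType) (mu : R) n :
  'X * (genHermite_odd mu n)^`() + (2 * mu) *: genHermite_odd mu n =
  ((2 * n).+1%:R + 2 * mu) *: ('X * genHermite_even mu n).
Proof.
rewrite /genHermite_even /genHermite_odd raddf_sum /= !mulr_sumr !scaler_sumr.
rewrite -big_split; apply: eq_bigr => k _ /=.
rewrite derivZ derivXn addn1 /= -['X^_ *+ _]scaler_nat -!['X * _]scalerAr -exprS.
rewrite !scalerA -scalerDl; congr (_ *: _).
set a := n%:R + mu + 1 / 2%:R.
have -> : n%:R + mu - 1 / 2%:R = a - 1 by rewrite /a; field.
(* On the left, term k carries the factor 2 k + 1 + 2 mu = 2 (a - (n - k)), on the right 2 a with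
   upper argument a - 1. *)
have := mul_gbinom_subr1 _ a (n - k).
have lekn : (k <= n)%N by rewrite -ltnS.
rewrite natrB // => gE.
have -> : (2 * n).+1%:R + 2 * mu = 2 * a by rewrite /a -natr1 natrM; field.
have -> t : 2 * a * (gbinom (a - 1) (n - k) * t)
          = 2 * (a * gbinom (a - 1) (n - k)) * t by ring.
rewrite -gE /a -[(2 * k).+1%:R]natr1 natrM; field.
by rewrite pnatr_eq0 -lt0n fact_gt0.
Qed.

Theorem proposition2p20 (R : realType) (m n : nat) (hmn : (m <= n)%N)
    (xi eta : R) (hxi : 0 < xi) (heta : 0 < eta)
    (hcons : consecutive_roots (genHermite (- m%:R) n.+1) xi eta) :
  exists zeta : R,
    [/\ 0 < zeta, root (genHermite (- m%:R) n) zeta & xi < zeta < eta].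
Proof.
case: hcons => rxi reta ltxe _; move: rxi reta.
have pos x : xi <= x <= eta -> 0 < x by case/andP => /(lt_le_trans hxi).
rewrite -(odd_double_half n) /genHermite.
set k := n./2; case: (odd n); rewrite ?add1n ?add0n /=.
  rewrite negbK !odd_double /= uphalf_double doubleK => rxi reta.
  (* Here n = 2 k + 1, and the denominator 1 gives the plain Rolle theorem. *)
  have [|c cI rc] := root_wronskian_between _ _ 1 _ _ ltxe rxi reta.
    by move=> x _; rewrite hornerC oner_neq0.
  exists c; split=> //; first by apply: lt_trans hxi _; case/andP: cI.
  move: rc; rewrite derivC mulr0 subr0 mulr1 deriv_genHermite_even rootZ //.
  by rewrite pnatr_eq0.
rewrite !odd_double /= uphalf_double doubleK => rxi reta.
(* Here n = 2 k; since mu = -m, the weight x^(2 mu) is the inverse of x^(2 m), which does not vanish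
   for x > 0. *)
have [|c cI rc] := root_wronskian_between _ _ ('X^(2 * m)) _ _ ltxe rxi reta.
  by move=> x /pos x0; rewrite hornerXn expf_neq0 // gt_eqF.
have c0 : 0 < c by apply: lt_trans hxi _; case/andP: cI.
exists c; split=> //.
move: rc; set H := genHermite_odd _ _ => rc.
have rD : root ('X * H^`() + (2 * - m%:R) *: H) c.
  (* The extra factor ['X] avoids the exponent 2 m - 1, so that m = 0 fits the same formula. *)
  have XdXn : 'X * ('X^(2 * m))^`() = (2 * m)%:R *: 'X^(2 * m) :> {poly R}.
    case: (2 * m)%N => [|j]; first by rewrite derivC mulr0 scale0r.
    by rewrite derivXn mulrnAr -exprS scaler_nat.
  have : root ('X^(2 * m) * ('X * H^`() + (2 * - m%:R) *: H)) c.
    have -> : 'X^(2 * m) * ('X * H^`() + (2 * - m%:R) *: H) =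
              'X * (H^`() * 'X^(2 * m) - H * ('X^(2 * m))^`()).
      rewrite mulrN -natrM scaleNr -!mul_polyC.
      move: XdXn; rewrite -mul_polyC => XdXn.
      rewrite [RHS]mulrBr [X in _ = _ - X]mulrCA XdXn; ring.
    by rewrite rootM rc orbT.
  (* The factor ['X^(2 * m)] cancels because c > 0. *)
  by rewrite rootM /root hornerXn expf_eq0 gt_eqF // andbF.
have odd_coef : (2 * k).+1%:R + 2 * - m%:R != 0 :> R.
  rewrite mulrN -natrM subr_eq0 eqr_nat; apply/eqP => /(congr1 odd).
  by rewrite /= !oddM.
by move: rD; rewrite deriv_genHermite_odd rootZ // rootM rootX gt_eqF.
Qed.
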